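(* Let $n \in \mathbb{N}$ with $n > 1$ composite. Then $$U(n) := (2 \mathbin{\dot{-}} \chi(n)) \cdot \gcd\left(n, \left\lfloor \sqrt[\omega(n)]{n} \right\rfloor !\right) + \bigl(1 \mathbin{\dot{-}} (2 \mathbin{\dot{-}} \chi(n))\bigr) \cdot \chi(n)$$ is a non-trivial divisor of $n$, i.e. $U(n) \mid n$ and $1 < U(n) < n$.
   Context: $a \mathbin{\dot{-}} b = \max(a-b,0)$. For $n \geq 1$, $\chi(n) = \max\{ s \in \mathbb{N} : s^2 \mid n \}$ and $\omega(n)$ is the number of distinct primes dividing $n$. $\lfloor \sqrt[m]{n} \rfloor$ denotes the largest natural number $r$ with $r^m \leq n$. *)

(* Defs.v *)
From mathcomp Require Import all_boot.

Set Implicit Arguments.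
Unset Strict Implicit.
Unset Printing Implicit Defensive.

(* ssrnat's m - n is truncated, so on nat it is max (m - n, 0). *)

(* The largest s with s ^ 2 %| n, for n > 0. The bound s <= n only makes the
   range finite: it follows from s ^ 2 %| n; see chi_dvd and chi_max. *)
Definition chi (n : nat) : nat := \max_(s < n.+1 | s ^ 2 %| n) s.

Lemma chi_dvd (n : nat) : 0 < n -> chi n ^ 2 %| n.
Proof.
move=> n_gt0; have lt1n : 1 < n.+1 by [].
have P1 : Ordinal lt1n ^ 2 %| n by rewrite exp1n dvd1n.
by rewrite /chi (bigmax_eq_arg _ P1); case: arg_maxnP.
Qed.

Lemma chi_max (n s : nat) : 0 < n -> s ^ 2 %| n -> s <= chi n.
Proof.
move=> n_gt0 s2n; have lt_s : s < n.+1.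
  rewrite ltnS (leq_trans _ (dvdn_leq n_gt0 s2n)) //.
  by case: (s) => // k; rewrite -mulnn leq_pmulr.
exact: (@leq_bigmax_cond _ (fun i : 'I_n.+1 => i ^ 2 %| n)
          (fun i : 'I_n.+1 => i) (Ordinal lt_s)).
Qed.

Definition omega (n : nat) : nat := size (primes n).

(* The largest r with r ^ m <= n, for m > 0. The bound r <= n only makes the
   range finite; see floor_root_exp and floor_root_max. *)
Definition floor_root (m n : nat) : nat := \max_(r < n.+1 | r ^ m <= n) r.

Lemma floor_root_exp (m n : nat) : 0 < m -> floor_root m n ^ m <= n.
Proof.
move=> m_gt0.
have P0 : @ord0 n ^ m <= n by rewrite exp0n.
by rewrite /floor_root (bigmax_eq_arg _ P0); case: arg_maxnP.
Qed.

Lemma floor_root_max (m n r : nat) :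
  0 < m -> r ^ m <= n -> r <= floor_root m n.
Proof.
move=> m_gt0 rmn; have lt_r : r < n.+1.
  rewrite ltnS; case: r rmn => // r; apply: leq_trans.
  by rewrite -{1}(expn1 r.+1) leq_pexp2l.
exact: (@leq_bigmax_cond _ (fun i : 'I_n.+1 => i ^ m <= n)
          (fun i : 'I_n.+1 => i) (Ordinal lt_r)).
Qed.

Definition U (n : nat) : nat :=
  (2 - chi n) * gcdn n (floor_root (omega n) n)`!
  + (1 - (2 - chi n)) * chi n.

(* Main.v *)
(** If [1 < chi n], then [U n = chi n] works because [chi n ^ 2 %| n].
    Otherwise [n] is a product of [m = omega n >= 2] distinct primes, so its
    [m]-th root lies strictly between its smallest and its largest prime factor:
    the factorial of the rounded-down root is divisible by the former and not
    by the latter. *)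
Require Import Defs.
From mathcomp Require Import all_boot.

Lemma prime_dvd_fact (p n : nat) : prime p -> (p %| n`!) = (p <= n).
Proof.
move=> p_pr; apply/idP/idP => [|le_pn]; last by rewrite dvdn_fact ?prime_gt0.
elim: n => [|n IHn]; first by rewrite fact0 Euclid_dvd1.
by rewrite factS Euclid_dvdM // => /orP[/dvdn_leq-> | /IHn/leqW].
Qed.

(** An exponent [logn p n] of at least 2 would make [p ^ 2] divide [n], so [p <= chi n <= 1],
    impossible for a prime. *)
Lemma prod_primes_squarefree (n : nat) :
  0 < n -> chi n <= 1 -> \prod_(p <- primes n) p = n.
Proof.
move=> n_gt0 chi1; rewrite [RHS]prod_prime_decomp // prime_decompE big_map.
rewrite !big_seq; apply: eq_bigr => p p_n /=.
suff -> : logn p n = 1 by rewrite expn1.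
apply/eqP; rewrite eqn_leq logn_gt0 p_n andbT leqNgt.
move: p_n; rewrite mem_primes => /and3P[p_pr _ _].
rewrite -pfactor_dvdn //; apply/negP => /(chi_max n_gt0)/leq_trans/(_ chi1).
by rewrite leqNgt prime_gt1.
Qed.

Lemma leq_prod_exp_size (s : seq nat) (r : nat) :
  all (leq^~ r) s -> \prod_(p <- s) p <= r ^ size s.
Proof.
elim: s => [|p s IHs] /=; first by rewrite big_nil.
by case/andP=> pr /IHs; rewrite big_cons expnS; apply: leq_mul.
Qed.

Lemma geq_exp_size_prod (s : seq nat) (r : nat) :
  all (leq r) s -> r ^ size s <= \prod_(p <- s) p.
Proof.
elim: s => [|p s IHs] /=; first by rewrite big_nil.
by case/andP=> pr /IHs; rewrite big_cons expnS; apply: leq_mul.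
Qed.

(** Strictness comes from the head, which is below the second entry and hence below [r]; the other
    factors need only the weak bound. *)
Lemma ltn_prod_exp_size (s : seq nat) (r : nat) :
  sorted ltn s -> 1 < size s -> all (leq^~ r) s ->
  \prod_(p <- s) p < r ^ size s.
Proof.
case: s => [|p [|q s]] //= /andP[lt_pq _] _ /andP[_ qs_r].
have lt_pr : p < r by case/andP: qs_r => /(leq_trans lt_pq).
have r_gt0 : 0 < r by apply: leq_ltn_trans lt_pr.
rewrite big_cons expnS; apply: (@leq_ltn_trans (p * r ^ (size s).+1)).
  by rewrite leq_mul2l (leq_prod_exp_size (q :: s)) ?orbT.
by rewrite ltn_pmul2r ?expn_gt0 ?r_gt0.
Qed.

Theorem mainTheorem7 (n : nat) (n_gt1 : 1 < n) (n_composite : ~~ prime n) :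
  U n %| n /\ 1 < U n < n.
Proof.
have n_gt0 : 0 < n by apply: ltnW.
have chi_gt0 : 0 < chi n by apply: chi_max; rewrite // dvd1n.
have [chi1 | chi_gt1] := leqP (chi n) 1; last first.
  have -> : U n = chi n.
    (* [1 < chi n] unfolds to [2 - chi n == 0], which settles both coefficients. *)
    by rewrite /U; move/eqP: chi_gt1 => ->; rewrite mul0n subn0 mul1n.
  have chi2n := chi_dvd n_gt0.
  split; first by apply: dvdn_trans chi2n; rewrite dvdn_exp.
  rewrite chi_gt1 (leq_trans _ (dvdn_leq n_gt0 chi2n)) //.
  by rewrite -mulnn ltn_Pmull.
have -> : U n = gcdn n (floor_root (omega n) n)`!.
  have chiE : chi n = 1 by apply/eqP; rewrite eqn_leq chi1.
  by rewrite /U chiE mul1n addn0.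
have prodE := prod_primes_squarefree n n_gt0 chi1.
have om_gt1 : 1 < omega n.
  (* With no prime factor [n] would be 1; with only one, [n] would be that prime. *)
  rewrite /omega ltnNge; apply/negP; move: prodE.
  case E: (primes n) => [|p [|q s]] // prodE _.
    by rewrite -prodE big_nil in n_gt1.
  have : p \in primes n by rewrite E inE.
  rewrite big_seq1 in prodE.
  by rewrite mem_primes prodE (negPf n_composite).
have om_gt0 := ltnW om_gt1.
set r := floor_root _ _.
have pdiv_le_r : pdiv n <= r.
  (* All [omega n] prime factors are at least [pdiv n], so [pdiv n ^ omega n <= n]. *)
  apply: floor_root_max => //; rewrite -[leqRHS]prodE.
  apply: geq_exp_size_prod; apply/allP => p.
  rewrite mem_primes => /and3P[p_pr _ p_n].
  by rewrite /= pdiv_min_dvd ?prime_gt1.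
split; first exact: dvdn_gcdl.
apply/andP; split.
  apply: (leq_trans (prime_gt1 (pdiv_prime n_gt1))); apply: dvdn_leq.
    by rewrite gcdn_gt0 n_gt0.
  by rewrite dvdn_gcd pdiv_dvd prime_dvd_fact ?pdiv_prime.
rewrite ltn_neqAle dvdn_leq ?dvdn_gcdl // andbT.
(* If [n] divided the factorial of [r], all its prime factors would be at most [r]; being distinct
   and at least two, they would give [n < r ^ omega n]. *)
apply/negP => /eqP/gcdn_idPl n_dvd.
have := floor_root_exp n om_gt0; rewrite leqNgt => /negP; apply.
rewrite -[ltnLHS]prodE; apply: ltn_prod_exp_size => //.
  exact: sorted_primes.
apply/allP => p; rewrite mem_primes => /and3P[p_pr _ p_n].
by rewrite /= -prime_dvd_fact // (dvdn_trans p_n n_dvd).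
Qed.
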